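(* The finite cyclic groups with the PT property are exactly the subgroups of the groups $$\mathbb{Z}_{p_1^{n}p_2p_3\cdots p_k},\qquad \mathbb{Z}_{p_1^2p_2^2},$$ where $p_1,p_2,p_3,\dots,p_k$ are distinct primes and $n\ge 1$ is any positive integer.
   Context: $\mathbb{Z}_N$ denotes the cyclic group of order $N$ (written additively). For a finite abelian group $G$, a pair $(\Omega,T)$ of subsets of $G$ is a tiling pair if every $g\in G$ can be written uniquely as $g=\omega+t$ with $\omega\in\Omega$, $t\in T$. A nonempty subset $A\subset G$ is periodic if there is a nonzero $g\in G$ with $A+g=A$. $G$ has the periodic tiling property (PT property) if for every tiling pair $(\Omega,T)$ of $G$, either $\Omega$ is periodic, or there is a periodic set $T'\subset G$ such that $(\Omega,T')$ is also a tiling pair.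
   Formalization: The trivial group is excluded: it is a subgroup of every listed group but fails the PT property as defined, since ({0},{0}) is a tiling pair and the group has no nonzero element, hence no periodic subset. *)

(* Defs.v *)
From HB Require Import structures.
From mathcomp Require Import all_boot all_fingroup all_algebra all_solvable.

Set Implicit Arguments.
Unset Strict Implicit.
Unset Printing Implicit Defensive.

Import GroupScope.

(* Groups are written multiplicatively, as everywhere in fingroup; on 'Z_M the
   group law [*] of group_scope is addition modulo M and [1] is the residue 0.
   The definitions are meant for a finite abelian group G. *)

Definition tiling_pair (gT : finGroupType) (G : {group gT})
    (Omega T : {set gT}) : Prop :=
  [/\ Omega \subset G, T \subset G &
      forall g : gT, g \in G ->
        exists! wt : gT * gT,
          [/\ wt.1 \in Omega, wt.2 \in T & g = wt.1 * wt.2]].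

Definition periodic (gT : finGroupType) (G : {group gT})
    (A : {set gT}) : Prop :=
  [/\ A \subset G, A != set0 &
      exists g : gT, [/\ g \in G, g != 1 & A :* g = A]].

Definition PT_property (gT : finGroupType) (G : {group gT}) : Prop :=
  forall Omega T : {set gT}, tiling_pair G Omega T ->
    periodic G Omega \/
    exists T' : {set gT}, periodic G T' /\ tiling_pair G Omega T'.

(* 'Z_M has order M only for M > 1; this is used with such M only. *)
Definition isog_subgroup_Z (gT : finGroupType) (G : {group gT})
    (M : nat) : Prop :=
  exists H : {group 'Z_M}, G \isog H.

(* Main.v *)
Require Import Defs.
From mathcomp Require Import all_boot all_fingroup all_algebra all_solvable.
From mathcomp Require Import zify.

Import GroupScope.

(* If (A, B) tiles a cyclic group and r is prime to |A|, then A may be replaced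
   by its r-th powers. Hence no quotient of A and quotient of B, both nontrivial,
   generate the same subgroup of a cyclic p-group, and there one of the factors
   has a period of order p. If at most one prime p has its square dividing |G|
   and Omega tiles G with T, then either some other prime l divides |T|, so not
   |Omega|, and Omega can be moved away from the l-part, which gives a periodic
   complement; or |T| is a power of p, and T can be moved into the Sylow
   p-subgroup, which reduces to p-groups. In order p^2 q^2 the remaining case is
   |Omega| = |T| = pq; one of the two factors then lies in a coset of a subgroup
   of prime index, which reduces to the previous arguments. When p^2 q^2 properly
   divides |G|, an explicit aperiodic Omega has only aperiodic complements. *)

Section Tilings.

Set Implicit Arguments.
Unset Strict Implicit.

Variable gT : finGroupType.
Implicit Types (G H K : {group gT}) (A B R S T : {set gT}).

(** * Basic facts about tilings *)

Lemma tilingP G A B :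
  tiling_pair G A B <->
  [/\ A \subset G, B \subset G,
      forall g, g \in G -> exists a b, [/\ a \in A, b \in B & g = a * b] &
      forall a a' b b', a \in A -> a' \in A -> b \in B -> b' \in B ->
        a * b = a' * b' -> a = a' /\ b = b'].
Proof.
split=> [[sAG sBG tAB] | [sAG sBG cAB iAB]]; split=> //.
- move=> g /tAB[[a b] [[/= Aa Bb ->] _]].
  by exists a, b.
- move=> a a' b b' Aa Aa' Bb Bb' eq_ab.
  have Gab : a * b \in G by rewrite groupM ?(subsetP sAG a) ?(subsetP sBG b).
  have [ab0 [_ uniq_ab]] := tAB _ Gab.
  have /= eq1 := uniq_ab (a, b); have /= eq2 := uniq_ab (a', b').
  by have [-> ->] : (a, b) = (a', b') by rewrite -eq1 // -eq2.
- move=> g /cAB[a [b [Aa Bb ->]]]; exists (a, b); split=> //= -[a' b'] /= [Aa' Bb'].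
  by case/iAB=> // -> ->.
Qed.

Lemma tiling_subl G A B : tiling_pair G A B -> A \subset G.
Proof. by case. Qed.

Lemma tiling_subr G A B : tiling_pair G A B -> B \subset G.
Proof. by case. Qed.

Lemma tiling_card G A B : tiling_pair G A B -> (#|A| * #|B|)%N = #|G|.
Proof.
case/tilingP=> sAG sBG cAB iAB; rewrite -cardsX.
pose f (ab : gT * gT) := ab.1 * ab.2.
have <- : f @: setX A B = G.
  apply/setP=> g; apply/imsetP/idP=> [[[a b]] | /cAB[a [b [Aa Bb ->]]]].
    case/setXP=> Aa Bb ->.
    by rewrite groupM ?(subsetP sAG a) ?(subsetP sBG b).
  by exists (a, b); rewrite // inE Aa.
rewrite card_in_imset // => -[a b] [a' b'] /setXP[Aa Bb] /setXP[Aa' Bb'].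
by case/iAB=> //= -> ->.
Qed.

(** By counting: the product map from pairs onto [G] cannot identify two pairs when there are at
    most [|G|] of them. *)
Lemma cover_tiling G A B :
    A \subset G -> B \subset G -> G \subset A * B -> #|A| * #|B| <= #|G| ->
  tiling_pair G A B.
Proof.
move=> sAG sBG sGAB leABG; pose f (ab : gT * gT) := ab.1 * ab.2.
have f_inj : {in setX A B &, injective f}.
  apply/imset_injP; rewrite eqn_leq leq_imset_card cardsX.
  apply: leq_trans leABG (subset_leq_card (subset_trans sGAB _)).
  apply/subsetP=> _ /mulsgP[a b Aa Bb ->].
  by apply/imsetP; exists (a, b); rewrite // inE Aa.
apply/tilingP; split=> // [g Gg | a a' b b' Aa Aa' Bb Bb' eq_ab].
  by have /mulsgP[a b Aa Bb ->] := subsetP sGAB g Gg; exists a, b.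
by have [-> ->] : (a, b) = (a', b') by apply: f_inj; rewrite ?inE /= ?Aa ?Aa'.
Qed.

Lemma tiling_sym G A B : abelian G -> tiling_pair G A B -> tiling_pair G B A.
Proof.
move=> abG tAB; have [sAG sBG cAB _] := (tilingP G A B).1 tAB.
apply: cover_tiling => //; last by rewrite mulnC (tiling_card tAB).
apply/subsetP=> g /cAB[a [b [Aa Bb ->]]]; apply/mulsgP; exists b a => //.
by apply: (centsP abG); [apply: (subsetP sAG) | apply: (subsetP sBG)].
Qed.

Lemma tiling_card_gt0 G A B : tiling_pair G A B -> 0 < #|A| /\ 0 < #|B|.
Proof.
move/tiling_card=> cAB; have := cardG_gt0 G.
by rewrite -cAB muln_gt0 => /andP.
Qed.

(** * Replacing a factor by its powers *)

(** A bounded discrete logarithm, used to turn group elements into exponents of polynomials; it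
    takes the default value 0 outside [<[x]>]. *)
Lemma cycle_log (x : gT) :
  exists e : gT -> nat,
    forall a, a \in <[x]> -> x ^+ e a = a /\ e a < #[x].
Proof.
exists (fun a => odflt 0%N (omap val [pick i : 'I_#[x] | x ^+ i == a])) => a.
case/cyclePmin=> i lt_i ->; case: pickP => [j /eqP xj | no_j].
  by rewrite /= xj.
by have /eqP[] := no_j (Ordinal lt_i).
Qed.

Section PowerTiling.

Local Open Scope ring_scope.
Import GRing.Theory.

(* In the group ring over F_q the Frobenius identity turns
   sum_(a in A) a^q * sum_(b in B) b into |A|^(q-1) times the sum over G. The
   group ring of a cyclic group is replaced by polynomials in the generator x
   together with the linear form collecting the coefficients of the exponents i
   such that x^i = g. *)
Lemma cover_expg_prime G A B (q : nat) (g : gT) :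
    cyclic G -> tiling_pair G A B -> prime q -> ~~ (q %| #|A|)%N -> g \in G ->
  exists a b, [/\ a \in A, b \in B & g = (a ^+ q * b)%g].
Proof.
move=> /cyclicP[x Gx] tAB q_pr q'A Gg.
have [sAG sBG cAB iAB] := (tilingP G A B).1 tAB.
have xG : x \in G by rewrite Gx cycle_id.
have [e eP] := cycle_log x; rewrite -{}Gx in eP.
have {}eA a : a \in A -> (x ^+ e a)%g = a /\ (e a < #[x])%N.
  by move/(subsetP sAG)/eP.
have {}eB b : b \in B -> (x ^+ e b)%g = b /\ (e b < #[x])%N.
  by move/(subsetP sBG)/eP.
set n := #[x] in eA eB; have n_gt0 : (0 < n)%N := order_gt0 x.
have q_gt0 := prime_gt0 q_pr.
(* Exponents in [PA ^+ q * PB] are at most [q (n - 1) + (n - 1) < N], so [phi] misses no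
   coefficient. *)
pose N := (q.+1 * n)%N; pose F := 'F_q.
pose phi (P : {poly F}) : F := \sum_(i < N | (x ^+ i)%g == g) P`_i.
have phi_sum (I : Type) (s : seq I) (S : pred I) (Q : I -> {poly F}) :
    phi (\sum_(i <- s | S i) Q i) = \sum_(i <- s | S i) phi (Q i).
  by rewrite /phi exchange_big /=; apply: eq_bigr => i _; rewrite coef_sum.
have phiXn m c : (m < N)%N -> phi (c *: 'X^m) = c *+ ((x ^+ m)%g == g).
  move=> lt_m; rewrite /phi big_mkcond (bigD1 (Ordinal lt_m)) //= big1 => [|i].
    by rewrite coefZ coefXn eqxx mulr1 addr0; case: eqP.
  rewrite -val_eqE /= => /negPf ne_i.
  by rewrite coefZ coefXn ne_i mulr0 if_same.
pose PA : {poly F} := \sum_(a in A) 'X^(e a).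
pose PB : {poly F} := \sum_(b in B) 'X^(e b).
have FrobA : PA ^+ q = \sum_(a in A) 'X^(q * e a).
  have q_char : q \in [pchar {poly F}] by rewrite pchar_poly pchar_Fp.
  rewrite -(pFrobenius_autE q_char) /PA (raddf_sum (pFrobenius_aut q_char)).
  by apply: eq_bigr => a _; rewrite /= pFrobenius_autE -exprM mulnC.
have lhs : phi (PA ^+ q * PB) =
    \sum_(a in A) \sum_(b in B) ((a ^+ q * b)%g == g)%:R.
  rewrite FrobA mulr_suml phi_sum; apply: eq_bigr => a Aa.
  rewrite mulr_sumr phi_sum; apply: eq_bigr => b Bb.
  have [[xa lt_a] [xb lt_b]] := (eA a Aa, eB b Bb).
  rewrite -exprD -[X in phi X]scale1r phiXn.
    by rewrite expgD mulnC expgM xa xb.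
  rewrite /N mulSn addnC -addSn leq_add // leq_mul2l.
  by rewrite (ltnW lt_a) orbT.
(* Write [PA ^+ q = P * PA]. For each monomial of degree [i] in [P], the tiling at [x^-i g] gives
   exactly one term of [PA * PB] leading to [g], so [phi] returns the coefficient sum [P.[1]]. *)
have rhs : phi (PA ^+ q * PB) = (#|A|%:R) ^+ q.-1.
  pose P := PA ^+ q.-1.
  have szP : (size P <= (q.-1 * n.-1).+1)%N.
    apply: leq_trans (size_poly_exp_leq _ _) _; rewrite ltnS mulnC leq_mul2l.
    rewrite -!subn1 leq_sub2r ?orbT //.
    apply: leq_trans (size_sum _ _ _) _; apply/bigmax_leqP=> a /eA[_ lt_a].
    by rewrite size_polyXn.
  have -> : PA ^+ q * PB =
      \sum_(i < size P) \sum_(a in A) \sum_(b in B) P`_i *: 'X^(i + e a + e b).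
    have -> : PA ^+ q = P * PA by rewrite /P -exprSr prednK.
    rewrite -mulrA -{1}[P]coefK poly_def mulr_suml.
    apply: eq_bigr => i _; rewrite -scalerAl mulrA.
    rewrite [_ * PA]mulr_sumr mulr_suml scaler_sumr.
    apply: eq_bigr => a _; rewrite mulr_sumr scaler_sumr.
    by apply: eq_bigr => b _; rewrite -!exprD.
  transitivity (P.[1]); last first.
    rewrite horner_exp /PA horner_sum; congr (_ ^+ _).
    rewrite -sumr_const; apply: eq_bigr => a _.
    by rewrite hornerXn expr1n.
  rewrite horner_coef phi_sum; apply: eq_bigr => i _.
  rewrite expr1n mulr1 phi_sum.
  have [|a0 [b0 [Aa0 Bb0 eq_g]]] := cAB (x ^- i * g)%g.
    by rewrite groupM // groupV groupX // xG.
  have lt_i : (i <= q.-1 * n.-1)%N by rewrite -ltnS (leq_trans (ltn_ord i)).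
  have phiE a b : a \in A -> b \in B ->
      phi (P`_i *: 'X^(i + e a + e b)) = P`_i *+ ((a == a0) && (b == b0)).
    move=> Aa Bb; have [[xa lt_a] [xb lt_b]] := (eA a Aa, eB b Bb).
    rewrite phiXn; last by rewrite /N; nia.
    congr (_ *+ nat_of_bool _); rewrite !expgD xa xb -mulgA.
    apply/eqP/andP=> [eq_ab | [/eqP-> /eqP->]]; last by rewrite -eq_g mulKVg.
    have [] := iAB a a0 b b0 => //; last by move=> -> ->; rewrite !eqxx.
    by rewrite -eq_g -eq_ab mulKg.
  rewrite (bigD1 a0) //= [X in _ + X]big1 => [|a /andP[Aa /negPf ne_a]]; last first.
    by rewrite phi_sum big1 // => b Bb; rewrite phiE // ne_a.
  rewrite phi_sum (bigD1 b0) //= big1 => [|b /andP[Bb /negPf ne_b]]; last first.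
    by rewrite phiE // ne_b andbF.
  by rewrite phiE // !eqxx !addr0.
(* Without a representation of [g], [lhs] vanishes, while [rhs] is nonzero because [q] does not
   divide [|A|]. *)
case: (boolP [exists a in A, exists b in B, g == (a ^+ q * b)%g]).
  by case/exists_inP=> a Aa /exists_inP[b Bb /eqP]; exists a, b.
move=> /exists_inPn no_ab.
have /eqP[] : phi (PA ^+ q * PB) != 0.
  rewrite rhs expf_neq0 // -(dvdn_pcharf (pchar_Fp q_pr)) //.
rewrite lhs big1 // => a Aa; rewrite big1 // => b Bb.
by have /exists_inPn/(_ b Bb) := no_ab a Aa; rewrite eq_sym => /negPf->.
Qed.
End PowerTiling.

(** Induction over the prime factors of [r]: each is prime to [|A|], a cardinal that the earlier
    powers preserve, and the covering obtained is a tiling by counting. *)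
Lemma tiling_expg G A B r :
    cyclic G -> tiling_pair G A B -> 0 < r -> coprime r #|A| ->
  tiling_pair G [set a ^+ r | a in A] B.
Proof.
move=> cycG tAB; elim/ltn_ind: r => r IHr r_gt0 co_rA.
case: (ltngtP r 1) => [|r_gt1|->]; first by rewrite ltnNge r_gt0.
  have [q_pr /dvdnP[m def_r]] := (pdiv_prime r_gt1, pdiv_dvd r).
  set q := pdiv r in q_pr def_r; have q_gt1 := prime_gt1 q_pr.
  have m_gt0 : 0 < m by move: r_gt0; rewrite def_r muln_gt0 => /andP[].
  move: co_rA; rewrite def_r coprimeMl => /andP[co_mA co_qA].
  have lt_mr : m < r by rewrite def_r ltn_Pmulr.
  have tmAB := IHr m lt_mr m_gt0 co_mA; have [smAG sBG _] := tmAB.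
  have cardmA : #|[set a ^+ m | a in A]| = #|A|.
    apply/eqP; rewrite -(eqn_pmul2r (tiling_card_gt0 tmAB).2).
    by rewrite (tiling_card tmAB) (tiling_card tAB).
  apply: cover_tiling => //.
  - apply/subsetP=> _ /imsetP[a Aa ->].
    by rewrite groupX // (subsetP (tiling_subl tAB)).
  - apply/subsetP=> g Gg.
    have [|_ [b [/imsetP[a Aa ->] Bb ->]]] := cover_expg_prime cycG tmAB q_pr _ Gg.
      by rewrite cardmA -prime_coprime.
    by apply/mulsgP; exists (a ^+ (m * q)) b; rewrite ?expgM ?imset_f //;
      apply/imsetP; exists a; rewrite ?expgM.
  - by rewrite -(tiling_card tAB) leq_mul2r leq_imset_card orbT.
rewrite (_ : [set _ | _ in _] = A) //.
by apply/setP=> a; apply/imsetP/idP=> [[b Ab ->] // | Aa]; exists a.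
Qed.

Lemma tiling_expg_inj G A B r a a' b b' :
    cyclic G -> tiling_pair G A B -> 0 < r -> coprime r #|A| ->
    a \in A -> a' \in A -> b \in B -> b' \in B ->
  a ^+ r * b = a' ^+ r * b' -> a = a' /\ b = b'.
Proof.
move=> cycG tAB r_gt0 co_rA Aa Aa' Bb Bb' eq_ab.
have trAB := tiling_expg cycG tAB r_gt0 co_rA.
have r_inj : {in A &, injective (fun a => a ^+ r)}.
  apply/imset_injP; rewrite -(eqn_pmul2r (tiling_card_gt0 tAB).2).
  by rewrite (tiling_card trAB) (tiling_card tAB).
have [_ _ _ /(_ (a ^+ r) (a' ^+ r) b b')[] //] := (tilingP _ _ _).1 trAB;
  try exact: imset_f.
by move/r_inj=> ->.
Qed.

(** The relation rearranges to [a^r b' = a'^r b], a collision in the tiling by powers. *)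
Lemma tiling_expg_diff G A B r a a' b b' :
    cyclic G -> tiling_pair G A B -> 0 < r -> coprime r #|A| ->
    a \in A -> a' \in A -> b \in B -> b' \in B ->
  b * b'^-1 = (a * a'^-1) ^+ r -> a = a' /\ b = b'.
Proof.
move=> cycG tAB r_gt0 co_rA Aa Aa' Bb Bb' eq_ab.
have [sAG sBG _] := tAB; have cGG := centsP (cyclic_abelian cycG).
have [Ga Ga'] := (subsetP sAG a Aa, subsetP sAG a' Aa').
have [Gb Gb'] := (subsetP sBG b Bb, subsetP sBG b' Bb').
have [] // := tiling_expg_inj cycG tAB r_gt0 co_rA Aa Aa' Bb' Bb.
rewrite -[b in RHS](mulgKV b') eq_ab expgMn; last by apply: cGG; rewrite ?groupV.
rewrite mulgA; congr (_ * _); rewrite cGG ?groupM ?groupX ?groupV //.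
by rewrite expgVn mulgKV.
Qed.

(** * Periods, and slices by a subgroup *)

Lemma periodicI G A g :
    A \subset G -> A != set0 -> g \in G -> g != 1 ->
  {in A, forall a, a * g \in A} -> periodic G A.
Proof.
move=> sAG ntA Gg ntg Ag; split=> //; exists g; split=> //.
apply/eqP; rewrite eqEcard card_rcoset leqnn andbT.
by apply/subsetP=> _ /rcosetP[a Aa ->]; apply: Ag.
Qed.

(** As [B] lies in [H], the factorization of [h g] with [h] in [H] takes its first factor in the
    coset [H g]. *)
Lemma tiling_slice G H A B g :
    abelian G -> H \subset G -> tiling_pair G A B -> B \subset H -> g \in G ->
  tiling_pair H (A :* g^-1 :&: H) B.
Proof.
move=> abG sHG /tilingP[sAG sBG cAB iAB] sBH Gg; apply/tilingP.
split=> // [|h Hh | a a' b b' /setIP[Aa _] /setIP[Aa' _] Bb Bb' eq_ab].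
- exact: subsetIr.
- have Gh := subsetP sHG h Hh.
  have [|a [b [Aa Bb def_hg]]] := cAB (h * g); first exact: groupM.
  have [Ga Gb] := (subsetP sAG a Aa, subsetP sBG b Bb).
  have eq_h : h = a * g^-1 * b.
    by rewrite -mulgA (centsP abG g^-1) ?groupV // mulgA -def_hg mulgK.
  exists (a * g^-1), b; split=> //; rewrite inE mem_rcoset invgK mulgKV Aa /=.
  by rewrite -(mulgK b (_ * _)) -eq_h groupM // groupV (subsetP sBH).
move: Aa Aa'; rewrite !mem_rcoset !invgK => Aa Aa'.
have cgB c : c \in B -> commute c g.
  by move/(subsetP sBG) => Gc; apply: (centsP abG).
have [|/mulIg-> ->] // := iAB (a * g) (a' * g) b b' Aa Aa' Bb Bb'.
by rewrite -!mulgA -!cgB // !mulgA eq_ab.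
Qed.

(** * Tilings of cyclic p-groups *)

(** If the common subgroup is nontrivial, one quotient is a power of the other with exponent prime
    to [p], hence to [|A|], and the tiling by powers applies. *)
Lemma tiling_in_pgroup_diff G A B (p : nat) a a' b b' :
    cyclic G -> p.-group G -> tiling_pair G A B ->
    a \in A -> a' \in A -> b \in B -> b' \in B ->
  <[a * a'^-1]> = <[b * b'^-1]> -> a = a' /\ b = b'.
Proof.
move=> cycG pG tAB Aa Aa' Bb Bb' eq_c; have [sAG sBG _] := tAB.
have : b * b'^-1 \in <[a * a'^-1]> by rewrite eq_c cycle_id.
have Gaa' : a * a'^-1 \in G by rewrite groupM ?groupV ?(subsetP sAG).
case/cycleP=> r def_b; have [/eqP|] := eqVneq #[a * a'^-1] 1%N.
  rewrite order_eq1 => /eqP aa1; move: eq_c; rewrite aa1 cycle1 => /esym/eqP.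
  rewrite cycle_eq1 => /eqP bb1.
  by rewrite -(mulgKV a' a) aa1 -(mulgKV b' b) bb1 !mul1g.
move=> nt_aa; have: generator <[a * a'^-1]> ((a * a'^-1) ^+ r).
  by rewrite -def_b /generator eq_c.
rewrite generator_coprime => co_r.
have r_gt0 : 0 < r by case: r co_r {def_b} => //; rewrite /coprime gcdn0 (negPf nt_aa).
apply: (tiling_expg_diff cycG tAB) def_b => //.
have [||p_pr p_dv _] := @pgroup_pdiv _ p <[a * a'^-1]>%G.
- by apply: pgroupS pG; rewrite cycle_subG.
- by rewrite cycle_eq1 -order_eq1.
rewrite coprime_sym (pnat_coprime (pi := p)) //.
  by apply: pnat_dvd pG; rewrite -(tiling_card tAB) dvdn_mulr.
by rewrite p'natE // -prime_coprime // (coprime_dvdl p_dv).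
Qed.

(** In a cyclic p-group the subgroup of order [p] lies in every nontrivial subgroup. *)
Lemma cycle_sub_pgroup G (p : nat) k y :
    cyclic G -> p.-group G -> k \in G -> #[k] = p -> y \in G -> y \notin <[k]> ->
  <[k]> \subset <[y]>.
Proof.
move=> cycG pG Gk ok Gy nKy; rewrite -(cardSg_cyclic cycG) ?cycle_subG //.
have [||_ p_dv _] := @pgroup_pdiv _ p <[y]>%G; last by rewrite -orderE ok.
  by apply: pgroupS pG; rewrite cycle_subG.
by apply: contraNneq nKy => /trivgP; rewrite cycle_subG => /set1P->; rewrite group1.
Qed.

Lemma mul_cycle_pgroup G (p : nat) k y z :
    cyclic G -> p.-group G -> k \in G -> #[k] = p -> y \in G -> y \notin <[k]> ->
  z \in <[k]> -> <[y * z]> = <[y]>.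
Proof.
move=> cycG pG Gk ok Gy nKy Kz.
have Gz : z \in G by apply: subsetP Kz; rewrite cycle_subG.
have nKyz : y * z \notin <[k]> by rewrite groupMr.
have sKy := cycle_sub_pgroup cycG pG Gk ok Gy nKy.
have sKyz := cycle_sub_pgroup cycG pG Gk ok (groupM Gy Gz) nKyz.
apply/eqP; rewrite eqEsubset !cycle_subG; apply/andP; split.
  by rewrite groupM ?cycle_id ?(subsetP sKy).
by rewrite -[X in X \in _](mulgK z y) groupM ?cycle_id // groupV (subsetP sKyz).
Qed.

(* The set A * {1, k} still meets B directly, so that it cannot exceed A. *)
Lemma tiling_pgroup_free_factor G A B (p : nat) k :
    cyclic G -> p.-group G -> tiling_pair G A B -> k \in G -> #[k] = p ->
    {in B &, forall b b', b * b'^-1 \in <[k]> -> b = b'} ->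
  {in A, forall a, a * k \in A}.
Proof.
move=> cycG pG tAB Gk ok injB; have [sAG sBG _] := tAB.
have cGG := centsP (cyclic_abelian cycG).
pose A' := A :|: A :* k.
have A'P x : x \in A' -> exists2 a, a \in A & a^-1 * x \in <[k]>.
  case/setUP=> [Ax | /rcosetP[a Aa ->]]; first by exists x; rewrite ?mulVg.
  by exists a; rewrite ?mulKg ?cycle_id.
have sA'G : A' \subset G.
  rewrite subUset sAG; apply/subsetP=> _ /rcosetP[a Aa ->].
  by rewrite groupM ?(subsetP sAG a).
have inj : {in setX A' B &, injective (fun u : gT * gT => u.1 * u.2)}.
  move=> [x b] [x' b'] /setXP[A'x Bb] /setXP[A'x' Bb'] /= eq_xb.
  suffices eq_b : b = b' by move: eq_xb; rewrite eq_b => /mulIg->.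
  have [[a Aa Kx] [a' Aa' Kx']] := (A'P x A'x, A'P x' A'x').
  have [Kb | nKb] := boolP (b' * b^-1 \in <[k]>); first exact/esym/injB.
  have [Ga Ga'] := (subsetP sAG a Aa, subsetP sAG a' Aa').
  have [Gb Gb'] := (subsetP sBG b Bb, subsetP sBG b' Bb').
  have [Gx Gx'] := (subsetP sA'G x A'x, subsetP sA'G x' A'x').
  (* Up to a factor in [<[k]>], the quotients [a / a'] and [b' / b] agree; the latter lies outside
     [<[k]>], so both generate the same subgroup. *)
  have eq_d : a * a'^-1 = b' * b^-1 * ((a^-1 * x)^-1 * (a'^-1 * x')).
    have -> : b' * b^-1 = x'^-1 * x by rewrite -[b'](mulKg x') -eq_xb mulgA mulgK.
    rewrite invMg invgK -!mulgA mulKVg [a * (_ * _)]mulgA (cGG x'^-1) ?groupM ?groupV //.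
    by rewrite mulgK.
  have [|_ ->] // := tiling_in_pgroup_diff cycG pG tAB Aa Aa' Bb' Bb.
  have Gbb : b' * b^-1 \in G by rewrite groupM ?groupV.
  have Kz : (a^-1 * x)^-1 * (a'^-1 * x') \in <[k]> by rewrite groupM ?groupV.
  by rewrite eq_d (mul_cycle_pgroup cycG pG Gk ok Gbb nKb Kz).
have le_A' : #|A'| <= #|A|.
  rewrite -(leq_pmul2r (tiling_card_gt0 tAB).2) (tiling_card tAB) -cardsX.
  rewrite -(card_in_imset inj) subset_leq_card //.
  apply/subsetP=> _ /imsetP[[x b] /setXP[A'x Bb] ->].
  by rewrite groupM ?(subsetP sA'G x) ?(subsetP sBG b).
have /eqP eqA : A == A' by rewrite eqEcard subsetUl le_A'.
by move=> a Aa; rewrite eqA inE mem_rcoset mulgK Aa orbT.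
Qed.

(** A nontrivial quotient in [<[k]>] generates [<[k]>], so the two factors cannot both contain
    distinct elements with such a quotient. The partner of a factor without them has period [k]. *)
Lemma tiling_pgroup G A B (p : nat) k :
    cyclic G -> p.-group G -> prime p -> tiling_pair G A B ->
    k \in G -> #[k] = p ->
  {in A, forall a, a * k \in A} \/ {in B, forall b, b * k \in B}.
Proof.
move=> cycG pG p_pr tAB Gk ok.
have [/existsP[b /existsP[b' /and4P[Bb Bb' ne_b Kb]]] | noB] := boolP
    [exists b, exists b', [&& b \in B, b' \in B, b != b' & b * b'^-1 \in <[k]>]].
  right; have tBA := tiling_sym (cyclic_abelian cycG) tAB.
  apply: (tiling_pgroup_free_factor cycG pG tBA Gk ok) => a a' Aa Aa' Ka.
  apply: contraNeq (ne_b) => ne_a.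
  have gen z z' : z != z' -> z * z'^-1 \in <[k]> -> <[z * z'^-1]> = <[k]>.
    move=> ne_z Kz; apply/esym/nt_gen_prime; first by rewrite -orderE ok.
    by rewrite !inE Kz -eq_mulgV1 ne_z.
  have [|_ ->] // := tiling_in_pgroup_diff cycG pG tAB Aa Aa' Bb Bb'.
  by rewrite (gen a a') ?(gen b b').
left; apply: (tiling_pgroup_free_factor cycG pG tAB Gk ok) => b b' Bb Bb' Kb.
apply: contraNeq noB => ne_b.
by apply/existsP; exists b; apply/existsP; exists b'; apply/and4P.
Qed.

(** * Periodic complements and periodic factors in cyclic groups *)

(* With r the l-part of |H|, the r-th powers of each slice of A still tile H
   together with B, so B' = {h in H | h^r in B} complements every slice at once;
   it is invariant under the Sylow l-subgroup of H. *)
Lemma coset_subgroup_periodic G H A B (l : nat) :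
    cyclic G -> H \subset G -> tiling_pair G A B -> B \subset H ->
    prime l -> l %| #|H| -> ~~ (l %| #|H| %/ #|B|) ->
  exists B', periodic G B' /\ tiling_pair G A B'.
Proof.
move=> cycG sHG tAB sBH l_pr lH l'A; have abG := cyclic_abelian cycG.
have [sAG sBG _] := tAB; have cycH := cyclicS sHG cycG.
have r_gt0 : 0 < #|H|`_l := part_gt0 _ _.
have lr : l %| #|H|`_l.
  by rewrite -{1}(part_pnat_id (pnat_id l_pr)) partn_dvd.
set r := (#|H|`_l)%N in r_gt0 lr.
have slice g : g \in G -> tiling_pair H (A :* g^-1 :&: H) B.
  by move=> Gg; apply: tiling_slice tAB sBH Gg.
have co_r g : g \in G -> coprime r #|A :* g^-1 :&: H|.
  move=> /slice tg; rewrite (pnat_coprime (pi := l)) ?part_pnat //.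
  by rewrite p'natE // -(mulnK #|_ :&: H| (tiling_card_gt0 tg).2) (tiling_card tg).
pose B' := [set h in H | h ^+ r \in B].
have sB'H : B' \subset H by apply/subsetP=> h; rewrite inE => /andP[].
have sB'G := subset_trans sB'H sHG.
have tAB' : tiling_pair G A B'.
  apply/tilingP; split=> // [g Gg | a a' b b' Aa Aa' B'b B'b' eq_ab].
    (* Writing [1 = w^r b] gives [b = (w^-1)^r], so [w^-1] is in [B'] and [g = (w g) w^-1]. *)
    have tg := tiling_expg cycH (slice g Gg) r_gt0 (co_r g Gg).
    have [_ _ /(_ 1 (group1 H))[_ [b [/imsetP[w Aw ->] Bb eq1]]] _] :=
      (tilingP _ _ _).1 tg.
    move: Aw; rewrite inE mem_rcoset invgK => /andP[Awg Hw].
    exists (w * g), w^-1; split=> //; last first.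
      by rewrite (centsP abG) ?mulKg ?groupV ?groupM // (subsetP sHG).
    by rewrite inE groupV Hw expgVn -[_^-1]mulg1 eq1 mulKg.
  pose g := a * b; have [Ga Gb] := (subsetP sAG a Aa, subsetP sB'G b B'b).
  have [Ga' Gb'] := (subsetP sAG a' Aa', subsetP sB'G b' B'b').
  have Gg : g \in G by rewrite groupM.
  move: B'b B'b'; rewrite !inE => /andP[Hb Bb] /andP[Hb' Bb'].
  have slb c d : c \in A -> d \in H -> d \in G -> g = c * d ->
      d^-1 \in A :* g^-1 :&: H.
    move=> Ac Hd Gd ->; rewrite inE groupV Hd andbT mem_rcoset invgK.
    by rewrite (centsP abG d^-1) ?groupV ?groupM ?mulgK // (subsetP sAG).
  (* Both [b^-1] and [b'^-1] lie in the slice at [g], and [(b^-1)^r b^r = 1 = (b'^-1)^r b'^r]. *)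
  have [|/invg_inj eq_b _] := tiling_expg_inj cycH (slice g Gg) r_gt0 (co_r g Gg)
    (slb _ _ Aa Hb Gb erefl) (slb _ _ Aa' Hb' Gb' eq_ab) Bb Bb'.
    by rewrite !expgVn !mulVg.
  by split=> //; move: eq_ab; rewrite eq_b => /mulIg.
exists B'; split=> //; have [k Hk ok] := Cauchy l_pr lH.
apply: (@periodicI _ _ k) => //; first 1 last.
- exact: (subsetP sHG).
- by rewrite -order_gt1 ok prime_gt1.
- move=> b; rewrite !inE => /andP[Hb Bb]; rewrite groupM //=.
  rewrite expgMn; last exact: (centsP (cyclic_abelian cycH)).
  by move: lr; rewrite -ok order_dvdn => /eqP->; rewrite mulg1.
by rewrite -card_gt0 (tiling_card_gt0 tAB').2.
Qed.

(* A power of B lies in the Sylow p-subgroup P; either it is periodic, or every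
   slice of A by a coset of P has the same period, of order p. *)
Lemma pgroup_factor_periodic G A B (p : nat) :
    cyclic G -> tiling_pair G A B -> prime p -> p %| #|G| -> p.-nat #|B| ->
  periodic G A \/ exists B', periodic G B' /\ tiling_pair G A B'.
Proof.
move=> cycG tAB p_pr pG pB; have abG := cyclic_abelian cycG.
have tBA := tiling_sym abG tAB; have [sBG sAG _] := tBA.
(* The exponent is the p'-part of [|G|]: it is prime to [|B|] and sends [G] into its Sylow
   p-subgroup. *)
have r_gt0 : 0 < #|G|`_p^' := part_gt0 _ _.
have co_r : coprime #|G|`_p^' #|B|.
  by rewrite coprime_sym (pnat_coprime pB) // part_pnat.
have tB1A := tiling_expg cycG tBA r_gt0 co_r.
set B1 := [set _ | _ in _] in tB1A; have tAB1 := tiling_sym abG tB1A.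
have [x defG] := cyclicP cycG; pose P := <[x ^+ (#|G|`_p^')%N]>%G.
have cardP : #|P| = (#|G|`_p)%N.
  rewrite -orderE orderXdiv orderE -defG ?dvdn_part //.
  by rewrite -{1}(partnC p (cardG_gt0 G)) mulnK.
have sPG : P \subset G by rewrite cycle_subG groupX // defG cycle_id.
have sB1P : B1 \subset P.
  apply/subsetP=> _ /imsetP[b Bb ->].
  have: b \in <[x]> by rewrite -defG (subsetP sBG).
  case/cycleP=> i ->.
  by rewrite -expgM mulnC expgM mem_cycle.
have pgP : p.-group P by rewrite /pgroup cardP part_pnat.
have pP : p %| #|P|.
  by rewrite cardP -{1}(part_pnat_id (pnat_id p_pr)) partn_dvd.
have [k Pk ok] := Cauchy p_pr pP; have Gk := subsetP sPG k Pk.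
have ntk : k != 1 by rewrite -order_gt1 ok prime_gt1.
have [[a Aa] [b Bb]] : (exists a, a \in A) /\ (exists b, b \in B1).
  have [/card_gt0P ? /card_gt0P ?] := tiling_card_gt0 tAB1; split; assumption.
have cycP := cyclicS sPG cycG.
have [/forall_inP B1k | /forall_inPn[b' Bb' nBb']] :=
  boolP [forall b in B1, b * k \in B1].
  right; exists B1; split=> //; apply: (@periodicI _ _ k) => //.
    exact: subset_trans sPG.
  by apply/set0Pn; exists b.
(* [B1] is not invariant under [k], so the slice of [A] at any [g] in [A] is; that slice contains 1,
   hence [k]. *)
left; apply: (@periodicI _ _ k) => //; first by apply/set0Pn; exists a.
move=> g Ag; have Gg := subsetP sAG g Ag.
have tg := tiling_slice abG sPG tAB1 sB1P Gg.
have [Ak | Bk] := tiling_pgroup cycP pgP p_pr tg Pk ok; last first.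
  by rewrite Bk in nBb'.
have /Ak : 1 \in A :* g^-1 :&: P by rewrite inE group1 mem_rcoset invgK mul1g Ag.
by rewrite inE mem_rcoset invgK mul1g (centsP abG k) // => /andP[].
Qed.

(** * Orders with at most one squared prime *)

Definition single_square (N p : nat) :=
  forall l, prime l -> l != p -> ~~ (l ^ 2 %| N).

Lemma PT_single_square_dvd G (p : nat) :
    cyclic G -> prime p -> p %| #|G| -> single_square #|G| p -> PT_property G.
Proof.
move=> cycG p_pr pG sqG A B tAB.
have [pB | pB] := boolP (p.-nat #|B|); first exact: (pgroup_factor_periodic cycG tAB p_pr).
right; have [_ B_gt0] := tiling_card_gt0 tAB.
have [l [l_pr lB ne_lp]] : exists l, [/\ prime l, l %| #|B| & l != p].
  move: pB; rewrite /pnat B_gt0 /= => /allPn[l].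
  by rewrite mem_primes => /and3P[l_pr _ lB] ne_l; exists l.
(* Here [H = G]; as [l] divides [|B|] and [l^2] does not divide [|G|], [l] does not divide [|A|]. *)
apply: (@coset_subgroup_periodic G G A B l) => //.
- by case: tAB.
- by rewrite -(tiling_card tAB) dvdn_mull.
rewrite -(tiling_card tAB) mulnK //.
apply: contra (sqG l l_pr ne_lp) => lA.
by rewrite -(tiling_card tAB) -mulnn dvdn_mul.
Qed.

(** * Subgroups of cyclic groups, prime periods, transversals and exchanges *)

Lemma cyclic_order_exists G d :
  cyclic G -> d %| #|G| -> exists2 x, x \in G & #[x] = d.
Proof.
move=> /cyclicP[x defG] dv_d; exists (x ^+ (#|G| %/ d)).
  by rewrite groupX // defG cycle_id.
have cardG : #[x] = #|G| by rewrite orderE -defG.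
rewrite orderXdiv cardG ?dvdn_div //.
by rewrite -{1}(divnK dv_d) mulKn // divn_gt0 ?(dvdn_leq _ dv_d) ?(dvdn_gt0 _ dv_d).
Qed.

Lemma cyclic_mem_order G x y :
  cyclic G -> x \in G -> y \in G -> (x \in <[y]>) = (#[x] %| #[y]).
Proof.
move=> cycG Gx Gy.
by rewrite -cycle_subG -(cardSg_cyclic cycG) ?cycle_subG // -!orderE.
Qed.

Lemma tiling_rcoset G A B g :
  tiling_pair G A B -> g \in G -> tiling_pair G A (B :* g).
Proof.
move=> tAB Gg; have [sAG sBG cAB iAB] := (tilingP _ _ _).1 tAB.
apply/tilingP; split=> // [|h Gh | a a' b b' Aa Aa'].
- by apply/subsetP=> _ /rcosetP[b Bb ->]; rewrite groupM // (subsetP sBG).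
- have [|a [b [Aa Bb def_h]]] := cAB (h * g^-1); first by rewrite groupM ?groupV.
  exists a, (b * g); rewrite mem_rcoset mulgK; split=> //.
  by rewrite mulgA -def_h mulgKV.
rewrite !mem_rcoset => Bb Bb' eq_ab.
have [|-> /mulIg-> //] := iAB _ _ _ _ Aa Aa' Bb Bb'.
by rewrite !mulgA eq_ab.
Qed.

Lemma periodic_rcoset G A g :
  abelian G -> g \in G -> periodic G A -> periodic G (A :* g).
Proof.
move=> abG Gg [sAG ntA [k [Gk ntk Ak]]]; split.
- by apply/subsetP=> _ /rcosetP[b Bb ->]; rewrite groupM // (subsetP sAG).
- by rewrite -card_gt0 card_rcoset card_gt0.
by exists k; split=> //; rewrite -rcosetM (centsP abG g) // rcosetM Ak.
Qed.

(** A power of the period has prime order; translation by it fixes no point of [A], so that prime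
    divides [|A|]. *)
Lemma periodic_prime G A :
    periodic G A ->
  exists k, [/\ k \in G, prime #[k], #[k] %| #|A| &
    forall a z, a \in A -> z \in <[k]> -> a * z \in A].
Proof.
case=> sAG ntA [g [Gg ntg Ag]].
have gA a n : a \in A -> a * g ^+ n \in A.
  move=> Aa; elim: n => [|n IHn]; first by rewrite mulg1.
  by rewrite expgSr mulgA -Ag mem_rcoset mulgK.
pose l := pdiv #[g]; have l_pr : prime l by rewrite pdiv_prime // order_gt1.
have lg : l %| #[g] by apply: pdiv_dvd.
pose k := g ^+ (#[g] %/ l).
have ok : #[k] = l.
  rewrite orderXdiv ?dvdn_div // -{1}(divnK lg) mulKn //.
  by rewrite divn_gt0 ?prime_gt0 // dvdn_leq.
have kA a z : a \in A -> z \in <[k]> -> a * z \in A.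
  by move=> Aa /cycleP[n ->]; rewrite -expgM gA.
exists k; split=> //; rewrite ?ok ?groupX //.
have Kl : l.-group <[k]> by rewrite /pgroup -orderE ok pnat_id.
have actA : [acts <[k]>, on A | 'R].
  apply/actsP=> z Kz a /=; apply/idP/idP=> [Aaz | Aa]; last exact: kA.
  by rewrite -(mulgK z a) kA ?groupV.
rewrite /dvdn (pgroup_fix_mod Kl actA).
have -> : 'Fix_(A | 'R)(<[k]>) = set0.
  apply/setP=> a; rewrite !inE; apply/negbTE; apply/negP=> /andP[_ fix_a].
  have := subsetP fix_a k (cycle_id k).
  rewrite inE -[X in _ == X]mulg1 => /eqP/mulgI k1.
  by have := prime_gt1 l_pr; rewrite -ok k1 order1.
by rewrite cards0 mod0n.
Qed.

(** The coset [H] itself is represented by 1, so that subsets of [H] lie in their products with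
    [R]. *)
Lemma tiling_transversal G H :
  H \subset G -> exists2 R, tiling_pair G H R & 1 \in R.
Proof.
move=> sHG; exists [set repr C | C in rcosets H G]; last first.
  apply/imsetP; exists (H :* 1); last by rewrite mulg1 repr_group.
  by apply/rcosetsP; exists 1.
have reprP r : r \in [set repr C | C in rcosets H G] ->
    r \in G /\ r = repr (H :* r).
  case/imsetP=> _ /rcosetsP[g Gg ->] ->; rewrite rcoset_repr; split=> //.
  have /rcosetP[h Hh ->] := mem_repr_rcoset H g.
  by rewrite groupM // (subsetP sHG).
apply/tilingP; split=> // [|g Gg | h h' r r' Hh Hh' Rr Rr' eq_hr].
- by apply/subsetP=> r /reprP[].
- have /rcosetP[h Hh def_r] := mem_repr_rcoset H g.
  exists h^-1, (repr (H :* g)); rewrite groupV; split=> //.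
    by apply: imset_f; apply/rcosetsP; exists g.
  by rewrite def_r mulKg.
suffices eq_r : r = r' by move: eq_hr; rewrite eq_r => /mulIg.
have [[_ ->] [_ ->]] := (reprP r Rr, reprP r' Rr'); congr repr.
have eqH h0 r0 : h0 \in H -> H :* (h0 * r0) = H :* r0.
  by move=> Hh0; rewrite rcosetM rcoset_id.
by rewrite -(eqH h r) // eq_hr eqH.
Qed.

Lemma tiling_extend G H A B R :
  tiling_pair H A B -> tiling_pair G H R -> tiling_pair G A (B * R).
Proof.
move=> /tilingP[sAH sBH cAB iAB] /tilingP[sHG sRG cHR iHR].
apply/tilingP; split.
- exact: subset_trans sHG.
- by rewrite mul_subG // (subset_trans sBH).
- move=> g /cHR[h [r [/cAB[a [b [Aa Bb ->]]] Rr ->]]].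
  by exists a, (b * r); rewrite mem_mulg ?mulgA.
move=> a a' _ _ Aa Aa' /mulsgP[b r Bb Rr ->] /mulsgP[b' r' Bb' Rr' ->].
rewrite !mulgA => eq_abr.
have Hab c d : c \in A -> d \in B -> c * d \in H.
  by move=> Ac Bd; rewrite groupM ?(subsetP sAH c) ?(subsetP sBH d).
by have [||/iAB[] // -> -> ->] := iHR _ _ r r' _ _ Rr Rr' eq_abr; rewrite ?Hab.
Qed.

(** [S' * B] takes over what [S * B] covered and the size does not grow, so counting applies. *)
Lemma tiling_swap G A B S S' :
    tiling_pair G A B -> S \subset A -> S' \subset G -> #|S'| <= #|S| ->
    S * B \subset S' * B ->
  tiling_pair G ((A :\: S) :|: S') B.
Proof.
move=> tAB sSA sS'G leS sSS'; have [sAG sBG cAB _] := (tilingP _ _ _).1 tAB.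
apply: cover_tiling => //.
- by rewrite subUset sS'G (subset_trans (subsetDl _ _)).
- apply/subsetP=> _ /cAB[a [b [Aa Bb ->]]].
  have [Sa | nSa] := boolP (a \in S); last by rewrite mem_mulg // !inE nSa Aa.
  apply: subsetP (subsetP sSS' _ (mem_mulg Sa Bb)).
  by rewrite mulSg ?subsetUr.
rewrite -(tiling_card tAB) leq_mul2r; apply/orP; right.
apply: leq_trans (leq_card_setU _ _) _.
by rewrite cardsD (setIidPr sSA); move: (subset_leq_card sSA) leS; lia.
Qed.

(** * Groups of order p^2 q^2 *)

(* A non-generator lies in one of the two maximal subgroups. If a, b in S avoid
   one coset s0 M each, then a / b lies in neither maximal subgroup. *)
Lemma no_generator_coset G S (p q : nat) :
    cyclic G -> prime p -> prime q -> p != q -> #|G| = (p ^ 2 * q ^ 2)%N ->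
    S \subset G -> S != set0 ->
    {in S &, forall s s', #[s * s'^-1] != #|G|} ->
  exists l s0, [/\ l \in [:: p; q], s0 \in S &
    {in S, forall s, #[s * s0^-1] %| #|G| %/ l}].
Proof.
move=> cycG p_pr q_pr ne_pq cardG sSG /set0Pn[s0 Ss0] noS.
have p_gt0 := prime_gt0 p_pr; have q_gt0 := prime_gt0 q_pr.
have maxG y : y \in G -> #[y] != #|G| ->
    (#[y] %| #|G| %/ p) || (#[y] %| #|G| %/ q).
  move=> Gy ne_y; have y_gt0 := order_gt0 y.
  have /dvdnP[d def_G] := order_dvdG Gy.
  have d_gt1 : 1 < d.
    case: d def_G => [|[|//]] def_G.
      by have := cardG_gt0 G; rewrite def_G.
    by rewrite def_G mul1n eqxx in ne_y.
  have [l_pr ld] := (pdiv_prime d_gt1, pdiv_dvd d).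
  have dvl : #[y] %| #|G| %/ pdiv d.
    by rewrite def_G mulnC -muln_divA // dvdn_mulr.
  have: (pdiv d == p) || (pdiv d == q).
    have: pdiv d %| p ^ 2 * q ^ 2 by rewrite -cardG def_G dvdn_mulr.
    by rewrite Euclid_dvdM // !Euclid_dvdX // !andbT !dvdn_prime2.
  by case/orP=> /eqP <-; rewrite dvl ?orbT.
have [Gs0 abG] := (subsetP sSG s0 Ss0, cyclic_abelian cycG).
have [Sp | /forall_inPn[a Sa nap]] :=
  boolP [forall s in S, #[s * s0^-1] %| #|G| %/ p].
  by exists p, s0; split; rewrite ?inE ?eqxx //; apply/forall_inP.
have [Sq | /forall_inPn[b Sb nbq]] :=
  boolP [forall s in S, #[s * s0^-1] %| #|G| %/ q].
  by exists q, s0; split; rewrite ?inE ?eqxx ?orbT //; apply/forall_inP.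
have Gd c d : c \in S -> d \in S -> c * d^-1 \in G.
  by move=> Sc Sd; rewrite groupM ?groupV ?(subsetP sSG c) ?(subsetP sSG d).
have aq : #[a * s0^-1] %| #|G| %/ q.
  by have := maxG _ (Gd a s0 Sa Ss0) (noS a s0 Sa Ss0); rewrite (negPf nap).
have bp : #[b * s0^-1] %| #|G| %/ p.
  by have := maxG _ (Gd b s0 Sb Ss0) (noS b s0 Sb Ss0); rewrite (negPf nbq) orbF.
(* Elements of order dividing [|G| / l] form a subgroup, so two of the quotients control the
   third. *)
have sub l c d : l %| #|G| -> c \in S -> d \in S ->
    #[c * s0^-1] %| #|G| %/ l -> #[c * d^-1] %| #|G| %/ l ->
  #[d * s0^-1] %| #|G| %/ l.
  move=> lG Sc Sd; have [z Gz <-] := cyclic_order_exists cycG (dvdn_div lG).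
  rewrite -!(cyclic_mem_order cycG) ?Gd // => zc zcd.
  rewrite (_ : d * s0^-1 = (c * d^-1)^-1 * (c * s0^-1)); first exact: groupM (groupVr zcd) zc.
  by rewrite invMg invgK -mulgA mulKg.
case/orP: (maxG _ (Gd a b Sa Sb) (noS a b Sa Sb)) => ab.
  case/negP: nap; apply: sub bp _ => //; first by rewrite cardG -mulnn -mulnA dvdn_mulr.
  by rewrite -[_ * _]invgK invMg invgK orderV.
case/negP: nbq; apply: sub aq ab => //.
by rewrite cardG -(mulnn q) mulnA dvdn_mull.
Qed.

Lemma PT_two_squares G (p q : nat) :
    cyclic G -> prime p -> prime q -> p != q -> #|G| = (p ^ 2 * q ^ 2)%N ->
  PT_property G.
Proof.
move=> cycG p_pr q_pr ne_pq cardG A B tAB; have abG := cyclic_abelian cycG.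
have [p_gt1 q_gt1] := (prime_gt1 p_pr, prime_gt1 q_pr).
have [p_gt0 q_gt0] := (prime_gt0 p_pr, prime_gt0 q_pr).
have [A_gt0 B_gt0] := tiling_card_gt0 tAB; have cAB := tiling_card tAB.
have [sAG sBG _] := tAB.
have tBA := tiling_sym abG tAB.
have pG : p %| #|G| by rewrite cardG -mulnn -mulnA dvdn_mulr.
have qG : q %| #|G| by rewrite cardG -(mulnn q) mulnA dvdn_mull.
have co_case l : prime l -> l %| #|G| -> ~~ (l %| #|A|) ->
    exists B', periodic G B' /\ tiling_pair G A B'.
  move=> l_pr lG lA; apply: (@coset_subgroup_periodic G G A B l) => //.
  by rewrite -cAB mulnK.
have [pA | /(co_case p p_pr pG)] := boolP (p %| #|A|); last by right.
have [qA | /(co_case q q_pr qG)] := boolP (q %| #|A|); last by right.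
have co_pq : coprime p q by rewrite prime_coprime // dvdn_prime2.
have pnat_case l m : prime l -> prime m -> #|G| = (l ^ 2 * m ^ 2)%N ->
    ~~ (l %| #|B|) -> m.-nat #|B|.
  move=> l_pr m_pr cG lB; have m_gt0 := prime_gt0 m_pr.
  have co_l : coprime (l ^ 2) #|B| by rewrite coprime_pexpl // prime_coprime.
  have: #|B| %| m ^ 2.
    by rewrite -(Gauss_dvdr _ (n := l ^ 2)) 1?coprime_sym // -cG -cAB dvdn_mull.
  by move/pnat_dvd; apply; rewrite pnatX pnat_id.
have [pB | /(pnat_case p q p_pr q_pr cardG)] := boolP (p %| #|B|); last first.
  exact: pgroup_factor_periodic.
have cardG' : #|G| = (q ^ 2 * p ^ 2)%N by rewrite cardG mulnC.
have [qB | /(pnat_case q p q_pr p_pr cardG')] := boolP (q %| #|B|); last first.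
  exact: pgroup_factor_periodic.
(* Both cardinals are now multiples of [p q], and their product is [p^2 q^2]. *)
have [cA cB] : #|A| = (p * q)%N /\ #|B| = (p * q)%N.
  have /dvdnP[a def_a] : p * q %| #|A| by rewrite Gauss_dvd ?pA.
  have /dvdnP[b def_b] : p * q %| #|B| by rewrite Gauss_dvd ?pB.
  have: (a * b * (p ^ 2 * q ^ 2) = 1 * (p ^ 2 * q ^ 2))%N.
    by rewrite mul1n -[RHS]cardG -cAB def_a def_b -expnMn -mulnn mulnACA.
  move/eqP; rewrite eqn_pmul2r; last by rewrite muln_gt0 !expn_gt0 p_gt0 q_gt0.
  by rewrite muln_eq1 => /andP[/eqP a1 /eqP b1]; rewrite def_a def_b a1 b1 !mul1n.
have ntA : A != set0 by rewrite -card_gt0.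
have ntB : B != set0 by rewrite -card_gt0.
have other l : l \in [:: p; q] -> exists m,
    [/\ prime l, prime m, l != m, #|G| = (l ^ 2 * m ^ 2)%N & (p * q = l * m)%N].
  rewrite !inE => /orP[] /eqP->; first by exists q.
  by exists p; split; rewrite // 1?eq_sym // mulnC.
have sub_max S l s0 : l \in [:: p; q] -> S \subset G -> s0 \in S ->
    {in S, forall s, #[s * s0^-1] %| #|G| %/ l} ->
  exists H, [/\ H \subset G, #|H| = #|G| %/ l & S :* s0^-1 \subset H].
  move=> l_in sSG Ss0 Sl; have [m [l_pr _ _ cG _]] := other l l_in.
  have lG : l %| #|G| by rewrite cG -mulnn -mulnA dvdn_mulr.
  have [z Gz oz] := cyclic_order_exists cycG (dvdn_div lG).
  exists <[z]>%G; rewrite cycle_subG -orderE; split=> //.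
  apply/subsetP=> _ /rcosetP[s Ss ->].
  rewrite (cyclic_mem_order cycG) ?oz ?Sl //.
  by rewrite groupM ?groupV ?(subsetP sSG).
(* A translate of [B] lies in [H] of order [l m^2], and [|H| / |B| = m] is prime to [l]. *)
have in_cosetB l b0 : l \in [:: p; q] -> b0 \in B ->
    {in B, forall b, #[b * b0^-1] %| #|G| %/ l} ->
  exists B', periodic G B' /\ tiling_pair G A B'.
  move=> l_in Bb0 Bl; have [m [l_pr m_pr ne_lm cG eq_lm]] := other l l_in.
  have [H [sHG cH sBH]] := sub_max B l b0 l_in sBG Bb0 Bl.
  have l_gt0 := prime_gt0 l_pr.
  have {}cH : #|H| = (l * m ^ 2)%N by rewrite cH cG -mulnn -mulnA mulKn.
  apply: (@coset_subgroup_periodic G H A (B :* b0^-1) l) => //.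
  - by apply: tiling_rcoset; rewrite ?groupV ?(subsetP sBG).
  - by rewrite cH dvdn_mulr.
  rewrite card_rcoset cB eq_lm cH -mulnn mulnA mulKn ?muln_gt0 ?l_gt0 ?prime_gt0 //.
  by rewrite dvdn_prime2.
(* A translate of [A] tiles [H], of order [l m^2], with a slice of [B]; only [m] is squared in
   [|H|]. *)
have in_cosetA l a0 : l \in [:: p; q] -> a0 \in A ->
    {in A, forall a, #[a * a0^-1] %| #|G| %/ l} ->
  periodic G A \/ exists B', periodic G B' /\ tiling_pair G A B'.
  move=> l_in Aa0 Al; have [m [l_pr m_pr ne_lm cG eq_lm]] := other l l_in.
  have [H [sHG cH sAH]] := sub_max A l a0 l_in sAG Aa0 Al.
  have l_gt0 := prime_gt0 l_pr; have Ga0 := subsetP sAG a0 Aa0.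
  have {}cH : #|H| = (l * m ^ 2)%N by rewrite cH cG -mulnn -mulnA mulKn.
  have tBA0 : tiling_pair G B (A :* a0^-1) by apply: tiling_rcoset; rewrite ?groupV.
  have A0K : A = A :* a0^-1 :* a0 by rewrite -rcosetM mulVg mulg1.
  have cycH := cyclicS sHG cycG.
  have tHA := tiling_sym (cyclic_abelian cycH)
    (tiling_slice abG sHG tBA0 sAH (group1 G)).
  have sqH : single_square #|H| m.
    move=> l' l'_pr ne_l'; rewrite cH; apply/negP=> l'lm.
    have co_l' : coprime (l' ^ 2) (m ^ 2).
      by rewrite coprime_pexpl // coprime_pexpr // prime_coprime // dvdn_prime2.
    move: l'lm; rewrite Gauss_dvdl // => l'l.
    have eq_l : l' = l.
      apply/eqP; rewrite -dvdn_prime2 //; apply: dvdn_trans l'l.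
      by rewrite -mulnn dvdn_mulr.
    move/dvdn_leq: l'l => /(_ l_gt0); rewrite eq_l -mulnn.
    by rewrite -{3}(muln1 l) leq_pmul2l // leqNgt prime_gt1.
  have mH : m %| #|H| by rewrite cH -mulnn mulnA dvdn_mull.
  have [[_ ntA0 [k [Hk ntk A0k]]] | [B' [perB' tB']]] :=
    PT_single_square_dvd cycH m_pr mH sqH tHA.
    left; rewrite A0K; apply: periodic_rcoset => //; split=> //.
      by case: tBA0.
    by exists k; rewrite (subsetP sHG).
  (* A transversal spreads the complement found in [H] over [G] and keeps its period. *)
  have [R tHR R1] := tiling_transversal sHG; have tA0 := tiling_extend tB' tHR.
  right; exists (B' * R); split; last first.
    by apply: tiling_sym => //; rewrite A0K; apply: tiling_rcoset => //; apply: tiling_sym.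
  case: perB' => sB'H ntB' [k [Hk ntk B'k]]; have Gk := subsetP sHG k Hk.
  have [_ sBRG _] := tA0; apply: (@periodicI _ _ k) => //.
    have /set0Pn[b B'b] := ntB'.
    by apply/set0Pn; exists (b * 1); rewrite mem_mulg.
  have [_ sRG _] := tHR.
  move=> _ /mulsgP[b r B'b Rr ->].
  rewrite -mulgA (centsP abG r) ?(subsetP sRG r) // mulgA mem_mulg //.
  by rewrite -B'k mem_rcoset mulgK.
have [/forall_inP noA | /forall_inPn[a Aa /forall_inPn[a' Aa' /negPn/eqP oA]]] :=
    boolP [forall s in A, forall s' in A, #[s * s'^-1] != #|G|].
  have [|l [a0 [l_in Aa0 Al]]] :=
    no_generator_coset cycG p_pr q_pr ne_pq cardG sAG ntA.
    by move=> s s' /noA/forall_inP; apply.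
  exact: in_cosetA l_in Aa0 Al.
(* [A] has a quotient generating [G]. One in [B] would be its r-th power with [r] prime to [|G|],
   against the tiling by powers. *)
right; have [|l [b0 [l_in Bb0 Bl]]] :=
  no_generator_coset cycG p_pr q_pr ne_pq cardG sBG ntB.
  move=> b b' Bb Bb'; apply/eqP=> oB.
  have Gaa : a * a'^-1 \in G by rewrite groupM ?groupV ?(subsetP sAG).
  have Gbb : b * b'^-1 \in G by rewrite groupM ?groupV ?(subsetP sBG).
  have : b * b'^-1 \in <[a * a'^-1]> by rewrite (cyclic_mem_order cycG) ?oA ?oB.
  case/cycleP=> r def_b.
  have co_r : coprime #|G| r.
    rewrite -oA -generator_coprime -def_b /generator.
    by rewrite (eq_subG_cyclic cycG) ?cycle_subG // -!orderE oA oB.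
  have G_gt1 : 1 < #|G| by apply: leq_trans (dvdn_leq (cardG_gt0 G) pG).
  have r_gt0 : 0 < r.
    by case: r co_r {def_b} => //; rewrite /coprime gcdn0 => /eqP G1; rewrite G1 in G_gt1.
  have co_rA : coprime r #|A|.
    by rewrite coprime_sym (coprime_dvdl _ co_r) // -cAB dvdn_mulr.
  have [eq_a _] := tiling_expg_diff cycG tAB r_gt0 co_rA Aa Aa' Bb Bb' def_b.
  by rewrite eq_a mulgV order1 in oA; rewrite -oA in G_gt1.
exact: in_cosetB l_in Bb0 Bl.
Qed.

(** * An aperiodic tile with only aperiodic complements *)

Lemma leq_card_mulset A B : #|A * B| <= #|A| * #|B|.
Proof.
rewrite -cardsX; apply: leq_trans (leq_imset_card (fun u : gT * gT => u.1 * u.2) _).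
apply: subset_leq_card; apply/subsetP=> _ /mulsgP[a b Aa Bb ->].
by apply/imsetP; exists (a, b); rewrite // inE Aa.
Qed.

(** The lowest digit of the exponent in base [n] gives [a]; the rest is a multiple of [n]. *)
Lemma order_digits (x : gT) n m :
    #[x] = (n * m)%N -> 0 < n ->
  forall z, z \in <[x]> ->
    exists2 a, a \in [set x ^+ (i : nat) | i : 'I_n] & a^-1 * z \in <[x ^+ n]>.
Proof.
move=> ox n_gt0 _ /cycleP[i ->]; exists (x ^+ (i %% n)).
  by apply/imsetP; exists (Ordinal (ltn_pmod i n_gt0)).
rewrite {2}(divn_eq i n) addnC expgD mulKg mulnC expgM.
exact: mem_cycle.
Qed.

(* Let H = <x> x <y> with x, y of orders p^2, q^2, and let u = x^p, v = y^q.
   The set A = {x^i y^j | i < p, j < q} complements both <u> <v> R and the set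
   O2 obtained from it by replacing <u> with x <u> and, in another coset H r,
   <v> r with y <v> r. This breaks the period v in H and the period u in H r, so
   O2 is aperiodic, but O2 keeps quotients equal to u and v. As every complement
   of O2 has pq elements, its periods of prime order could only lie in <u> or
   <v>, which those quotients forbid. *)
Lemma two_squares_not_PT G (p q : nat) :
    cyclic G -> prime p -> prime q -> p != q -> p ^ 2 * q ^ 2 %| #|G| ->
    #|G| != (p ^ 2 * q ^ 2)%N ->
  ~ PT_property G.
Proof.
move=> cycG p_pr q_pr ne_pq dvG neG; have abG := cyclic_abelian cycG.
have cG := centsP abG.
have [p_gt1 q_gt1] := (prime_gt1 p_pr, prime_gt1 q_pr).
have [p_gt0 q_gt0] := (prime_gt0 p_pr, prime_gt0 q_pr).
have co_pq : coprime p q by rewrite prime_coprime // dvdn_prime2.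
have [|x Gx ox] := @cyclic_order_exists G (p ^ 2) cycG.
  exact: dvdn_trans (dvdn_mulr _ _) dvG.
have [|y Gy oy] := @cyclic_order_exists G (q ^ 2) cycG.
  exact: dvdn_trans (dvdn_mull _ _) dvG.
pose u := x ^+ p; pose v := y ^+ q.
have ou : #[u] = p by rewrite orderXdiv ox -mulnn ?mulnK ?dvdn_mulr.
have ov : #[v] = q by rewrite orderXdiv oy -mulnn ?mulnK ?dvdn_mulr.
have [Gu Gv] : u \in G /\ v \in G by rewrite !groupX.
have ntu : u != 1 by rewrite -order_gt1 ou.
have ntv : v != 1 by rewrite -order_gt1 ov.
have co_xy : coprime #[x] #[y] by rewrite ox oy coprime_pexpl // coprime_pexpr.
have tiXY z : z \in <[x]> -> z \in <[y]> -> z = 1.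
  move=> Xz Yz; have : z \in <[x]> :&: <[y]> by rewrite inE Xz.
  by rewrite coprime_TIg // => /set1P.
have sUX : {subset <[u]> <= <[x]>} by apply/subsetP; rewrite cycle_subG mem_cycle.
have sVY : {subset <[v]> <= <[y]>} by apply/subsetP; rewrite cycle_subG mem_cycle.
have nUx : x \notin <[u]>.
  by rewrite (cyclic_mem_order cycG) // ox ou gtnNdvd // -mulnn ltn_Pmulr.
have nVy : y \notin <[v]>.
  by rewrite (cyclic_mem_order cycG) // oy ov gtnNdvd // -mulnn ltn_Pmulr.
pose H := <[x * y]>%G.
have defH : <[x * y]> = <[x]> * <[y]> by apply: cycleM => //; apply: cG.
have sHG : H \subset G by rewrite cycle_subG groupM.
have cardH : #|H| = (p ^ 2 * q ^ 2)%N
  by rewrite -orderE (orderM (cG x Gx y Gy) co_xy) ox oy.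
have sXH : {subset <[x]> <= H}.
  by move=> z Xz; rewrite /= defH -[z]mulg1 mem_mulg.
have sYH : {subset <[y]> <= H}.
  by move=> z Yz; rewrite /= defH -[z]mul1g mem_mulg.
have sXG z : z \in <[x]> -> z \in G by move/sXH/(subsetP sHG).
have sYG z : z \in <[y]> -> z \in G by move/sYH/(subsetP sHG).
have [R tHR R1] := tiling_transversal sHG.
have [_ sRG cHR iHR] := (tilingP _ _ _).1 tHR.
have uniqR h h' r r' : h \in H -> h' \in H -> r \in R -> r' \in R ->
    h * r = h' * r' -> h = h' /\ r = r'.
  by move=> Hh Hh' Rr Rr' /(iHR _ _ _ _ Hh Hh' Rr Rr').
(* Since [|G|] differs from [|H|], a second coset of [H] is available for the second change. *)
have [r Rr nHr] : exists2 r, r \in R & r \notin H.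
  have /subsetPn[g Gg nHg] : ~~ (G \subset H).
    by apply: contra neG => sGH; rewrite -cardH eqn_leq !subset_leq_card.
  have [h [r [Hh Rr def_g]]] := cHR g Gg; exists r => //.
  by apply: contra nHg => Hr; rewrite def_g groupM.
have Gr := subsetP sRG r Rr.
pose A1 := [set x ^+ (i : nat) | i : 'I_p].
pose A2 := [set y ^+ (i : nat) | i : 'I_q].
pose A := A1 * A2; pose K := <[u]> * <[v]>.
have sA1X : {subset A1 <= <[x]>} by move=> _ /imsetP[i _ ->]; apply: mem_cycle.
have sA2Y : {subset A2 <= <[y]>} by move=> _ /imsetP[i _ ->]; apply: mem_cycle.
have digX z : z \in <[x]> -> exists2 a, a \in A1 & a^-1 * z \in <[u]>.
  by apply: (@order_digits x p p) => //; rewrite ox mulnn.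
have digY z : z \in <[y]> -> exists2 a, a \in A2 & a^-1 * z \in <[v]>.
  by apply: (@order_digits y q q) => //; rewrite oy mulnn.
have cardA : #|A| <= p * q.
  apply: leq_trans (leq_card_mulset _ _) _.
  by apply: leq_mul; rewrite -[X in _ <= X]card_ord; apply: leq_imset_card.
have sKH : {subset K <= H}.
  by move=> _ /mulsgP[k l /sUX/sXH Hk /sVY/sYH Hl ->]; rewrite groupM.
have sAH : {subset A <= H}.
  by move=> _ /mulsgP[a b /sA1X/sXH Ha /sA2Y/sYH Hb ->]; rewrite groupM.
have cG_ACA (a b c d : gT) : b \in G -> c \in G -> a * b * (c * d) = a * c * (b * d).
  by move=> Gb Gc; rewrite -!mulgA; congr (a * _); rewrite !mulgA (cG b).
have tAK : tiling_pair H A K.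
  apply: cover_tiling; [exact/subsetP | exact/subsetP | |].
    apply/subsetP=> z; rewrite /= defH => /mulsgP[xz yz Xz Yz ->].
    have [[a A1a Ua] [b A2b Vb]] := (digX xz Xz, digY yz Yz).
    apply/mulsgP; exists (a * b) (a^-1 * xz * (b^-1 * yz)); rewrite ?mem_mulg //.
    by rewrite cG_ACA ?mulKVg // ?(sXG _ (sUX _ Ua)) ?(sYG _ (sA2Y _ A2b)).
  rewrite cardH -[(p ^ 2)%N]mulnn -[(q ^ 2)%N]mulnn mulnACA leq_mul //.
  by apply: leq_trans (leq_card_mulset _ _) _; rewrite -!orderE ou ov.
pose O0 := K * R.
have t0 : tiling_pair G O0 A by apply: tiling_sym => //; apply: tiling_extend tHR.
pose S1 : {set gT} := <[u]>; pose S1' := <[u]> :* x.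
pose S2 := <[v]> :* r; pose S2' := <[v]> :* (y * r).
have sS1H : {subset S1 <= H} by move=> z /sUX/sXH.
have sS1'H : {subset S1' <= H}.
  by move=> _ /rcosetP[k /sUX Xk ->]; apply: sXH; rewrite groupM ?cycle_id.
have nHS2 z : z \in S2 -> z \notin H.
  by case/rcosetP=> k /sVY/sYH Hk ->; rewrite groupMl.
have nHS2' z : z \in S2' -> z \notin H.
  case/rcosetP=> k /sVY Yk ->; rewrite mulgA groupMl // sYH //.
  by rewrite groupM ?cycle_id.
pose O1 := (O0 :\: S1) :|: S1'.
have t1 : tiling_pair G O1 A.
  apply: tiling_swap => //; rewrite ?card_rcoset //.
  - by apply/subsetP=> k Uk; rewrite -[k]mulg1 -[k]mulg1 !mem_mulg.
  - by apply/subsetP=> z /sS1'H; apply: (subsetP sHG).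
  (* [<[u]> * A1] is all of [<[x]>], which is stable under [x]; the new digit is that of
     [x^-1 k a]. *)
  apply/subsetP=> _ /mulsgP[k _ Uk /mulsgP[a b A1a A2b ->] ->].
  have Xka : k * a \in <[x]> by rewrite groupM ?(sUX k) ?(sA1X a).
  have Xz : x^-1 * (k * a) \in <[x]> by rewrite groupM ?groupV ?cycle_id.
  have [a' A1a' Uk'] := digX _ Xz; set k' := _ * _ in Uk'.
  apply/mulsgP; exists (k' * x) (a' * b); rewrite ?mem_rcoset ?mulgK ?mem_mulg //.
  have [Gk' Ga'] := (sXG _ (sUX _ Uk'), sXG _ (sA1X _ A1a')).
  rewrite !mulgA; congr (_ * b).
  have def_a' : a' * k' = x^-1 * (k * a) by rewrite mulKVg.
  rewrite (cG (k' * x) (groupM Gk' Gx) a' Ga') mulgA def_a'.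
  by rewrite (cG _ (sXG _ Xz) x Gx) mulKVg.
pose O2 := (O1 :\: S2) :|: S2'.
have t2 : tiling_pair G O2 A.
  apply: tiling_swap => //; rewrite ?card_rcoset //.
  - apply/subsetP=> z S2z; rewrite !inE; apply/orP; left.
    rewrite (contraNN (sS1H z) (nHS2 z S2z)).
    case/rcosetP: S2z => k Vk ->; apply: mem_mulg => //.
    by rewrite -[k]mul1g; apply: mem_mulg.
  - apply/subsetP=> _ /rcosetP[k Vk ->].
    by rewrite !groupM // sYG ?sVY.
  apply/subsetP=> _ /mulsgP[_ _ /rcosetP[k Vk ->] /mulsgP[a b A1a A2b ->] ->].
  have Ykb : k * b \in <[y]> by rewrite groupM ?(sVY k) ?(sA2Y b).
  have Yz : y^-1 * (k * b) \in <[y]> by rewrite groupM ?groupV ?cycle_id.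
  have [b' A2b' Vk'] := digY _ Yz; set k' := _ * _ in Vk'.
  apply/mulsgP; exists (k' * (y * r)) (a * b').
  - by rewrite mem_rcoset mulgK.
  - by rewrite mem_mulg.
  have [Gk' Gb'] := (sYG _ (sVY _ Vk'), sYG _ (sA2Y _ A2b')).
  have [Ga Gb] := (sXG _ (sA1X _ A1a), sYG _ (sA2Y _ A2b)).
  rewrite (cG a Ga b Gb) (cG a Ga b' Gb') cG_ACA // [k' * _]mulgA [RHS]cG_ACA //.
  congr (_ * _).
  have def_b' : b' * k' = y^-1 * (k * b) by rewrite mulKVg.
  rewrite (cG (k' * y) (groupM Gk' Gy) b' Gb') mulgA def_b'.
  by rewrite (cG _ (sYG _ Yz) y Gy) mulKVg.
have nKx k : k \in <[v]> -> x * k \notin K.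
  move=> Vk; apply/mulsgP=> -[u1 v1 Uu1 Vv1 eq_xk].
  have eq1 : u1^-1 * x = v1 * k^-1.
    by rewrite -(mulgK k x) eq_xk !mulgA mulVg mul1g.
  case/negP: nUx; rewrite (_ : x = u1) //; apply/(mulgI u1^-1).
  rewrite mulVg; apply: tiXY; first by rewrite groupM ?groupV ?cycle_id ?sUX.
  by rewrite eq1 groupM ?groupV ?sVY.
have nKy k : k \in <[u]> -> y * k \notin K.
  move=> Uk; apply/mulsgP=> -[u1 v1 Uu1 Vv1].
  rewrite (cG u1) ?(sXG _ (sUX _ Uu1)) ?(sYG _ (sVY _ Vv1)) // => eq_yk.
  have eq1 : v1^-1 * y = u1 * k^-1.
    by rewrite -(mulgK k y) eq_yk !mulgA mulVg mul1g.
  case/negP: nVy; rewrite (_ : y = v1) //; apply/(mulgI v1^-1).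
  rewrite mulVg; apply: tiXY; last by rewrite groupM ?groupV ?cycle_id ?sVY.
  by rewrite eq1 groupM ?groupV ?sUX.
(* These pairs in [O2] have quotients in [<[u]>] and [<[v]>], which complements must then avoid; the
   absence of [x v] and [y r u] shown next excludes [v] and [u] as periods of [O2]. *)
have O2x k : k \in <[u]> -> x * k \in O2.
  move=> Uk; have S1'xk : x * k \in S1'.
    by rewrite mem_rcoset (cG x) ?mulgK ?(sXG _ (sUX _ Uk)).
  by rewrite !inE S1'xk orbT andbT (contraTN (nHS2 _)) // sS1'H.
have O2yr k : k \in <[v]> -> y * r * k \in O2.
  move=> Vk; rewrite inE; apply/orP; right.
  by rewrite mem_rcoset (cG (y * r)) ?mulgK ?groupM ?(sYG _ (sVY _ Vk)).
have nO2xv : x * v \notin O2.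
  have Vv := cycle_id v; have Hxv : x * v \in H.
    by rewrite groupM ?(sXH x) ?(sYH v) ?sVY ?cycle_id.
  apply/negP; rewrite !inE => /orP[/andP[_ /orP[/andP[_]|]] | /nHS2'/negP//].
    case/mulsgP=> k r' Kk Rr' eq_xv.
    have [eq_k _] := uniqR (x * v) k 1 r' Hxv (sKH _ Kk) R1 Rr' (etrans (mulg1 _) eq_xv).
    by have := nKx v Vv; rewrite eq_k Kk.
  rewrite mem_rcoset (cG x) // mulgK => Uv.
  by case/eqP: ntv; apply: tiXY; [apply: sUX | apply: sVY].
have nO2yru : y * r * u \notin O2.
  have Uu := cycle_id u; have Hyu : y * u \in H.
    by rewrite groupM ?(sXH u) ?(sYH y) ?sUX ?cycle_id.
  have eq_yru : y * r * u = y * u * r by rewrite -!mulgA (cG r).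
  have nHyru : y * r * u \notin H by rewrite eq_yru groupMl.
  apply/negP; rewrite !inE => /orP[/andP[_ /orP[/andP[_]|]] |].
  - case/mulsgP=> k r' Kk Rr'; rewrite eq_yru => eq_yu.
    have [eq_k _] := uniqR (y * u) k r r' Hyu (sKH _ Kk) Rr Rr' eq_yu.
    by have := nKy u Uu; rewrite eq_k Kk.
  - by move/sS1'H; rewrite (negPf nHyru).
  rewrite mem_rcoset (cG (y * r) (groupM Gy Gr) u Gu) mulgK => Vu.
  by case/eqP: ntu; apply: tiXY; [apply: sUX | apply: sVY].
(* Outside [H] only whole cosets of [<[v]>] were exchanged, so [v] still acts there. *)
have O2V z : z \in O2 -> z \notin H -> z * v \in O2.
  move=> O2z nHz; have Vv := cycle_id v; have Hv : v \in H by rewrite sYH ?sVY.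
  have Gz := subsetP (tiling_subl t2) z O2z.
  have zvV g : g \in G -> (z * v \in <[v]> :* g) = (z \in <[v]> :* g).
    by move=> Gg; rewrite !mem_rcoset -mulgA (cG v) ?groupV // mulgA groupMr.
  move: O2z; rewrite !inE !zvV // ?(groupM Gy Gr) //.
  case/orP=> [/andP[->] | ->]; last by rewrite orbT.
  case/orP=> [/andP[_ O0z] | /sS1'H]; last by rewrite (negPf nHz).
  rewrite (contraNN (sS1H (z * v))); last by rewrite groupMr.
  suffices -> : z * v \in O0 by [].
  case/mulsgP: O0z => _ r' /mulsgP[u1 v1 Uu1 Vv1 ->] Rr' ->.
  apply/mulsgP; exists (u1 * (v1 * v)) r' => //; first by rewrite mem_mulg // groupM.
  by rewrite -!mulgA (cG r') // (subsetP sRG).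
have prime_uv k : k \in G -> prime #[k] -> #[k] %| p ^ 2 * q ^ 2 ->
    u \in <[k]> \/ v \in <[k]>.
  move=> Gk k_pr; rewrite Euclid_dvdM // !Euclid_dvdX // !andbT !dvdn_prime2 //.
  by case/orP=> /eqP ok; [left | right]; rewrite (cyclic_mem_order cycG) // ok ?ou ?ov.
case/(_ O2 A t2) => [/periodic_prime | [T' [/periodic_prime + tO2T']]].
  case=> k [Gk k_pr _ O2k]; have Kk := cycle_id k.
  have [Hk | nHk] := boolP (k \in H).
    have [|Uk|Vk] := prime_uv k Gk k_pr; first by rewrite -cardH order_dvdG.
      case/negP: nO2yru; apply: O2k => //.
      by rewrite -[_ * r]mulg1 O2yr.
    by case/negP: nO2xv; apply: O2k => //; rewrite -[x]mulg1 O2x.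
  (* A period [k] outside [H] carries [x] to [x k], where multiplication by [v] is allowed; going
     back by [k^-1] puts [x v] in [O2]. *)
  case/negP: nO2xv; have O2xk : x * k \in O2 by apply: O2k; rewrite // -[x]mulg1 O2x.
  rewrite -(mulgK k (x * v)) O2k ?groupV // -mulgA (cG v) // mulgA O2V //.
  by rewrite groupMl // sXH ?cycle_id.
case=> k [Gk k_pr]; have -> : #|T'| = #|A|.
  apply/eqP; rewrite -(eqn_pmul2l (tiling_card_gt0 t2).1).
  by rewrite (tiling_card t2) (tiling_card tO2T').
move=> dv_k T'k; have [_ _ _ iO2] := (tilingP _ _ _).1 tO2T'.
have /card_gt0P[t T't] := (tiling_card_gt0 tO2T').2.
have Gt := subsetP (tiling_subr tO2T') t T't.
have dv_H : #[k] %| p ^ 2 * q ^ 2.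
  by rewrite -cardH -(tiling_card tAK) dvdn_mulr.
(* For [t] in [T'], [(g z) t = g (t z)] would be two factorizations of one element. *)
have move_period g z : z \in <[k]> -> z \in G -> z != 1 -> g \in O2 -> g * z \in O2 -> False.
  move=> Kz Gz /eqP ntz O2g O2gz.
  have [|+ _] := iO2 _ _ _ _ O2gz O2g T't (T'k _ _ T't Kz).
    by rewrite -mulgA (cG z).
  by rewrite -[RHS]mulg1 => /mulgI.
have [Uk | Vk] := prime_uv k Gk k_pr dv_H.
  apply: (move_period x u) => //; last by rewrite O2x ?cycle_id.
  by rewrite -[x]mulg1 O2x.
apply: (move_period (y * r) v) => //; last by rewrite O2yr ?cycle_id.
by rewrite -[_ * r]mulg1 O2yr.
Qed.

(** * Arithmetic of the orders and the classification *)

Lemma prod_primes_square_free (ps : seq nat) l :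
    all prime ps -> uniq ps -> prime l -> ~~ (l ^ 2 %| \prod_(p <- ps) p)%N.
Proof.
move=> ps_pr ps_uniq l_pr; have [l_gt0 l_gt1] := (prime_gt0 l_pr, prime_gt1 l_pr).
have l2_gt1 : 1 < l ^ 2 by rewrite -mulnn; nia.
elim: ps ps_pr ps_uniq => [_ _|p s IHs /= /andP[p_pr s_pr] /andP[nsp s_uniq]].
  by rewrite big_nil dvdn1 gtn_eqF.
rewrite big_cons; have [eq_lp | ne_lp] := eqVneq l p; last first.
  by rewrite Gauss_dvdr ?IHs // coprime_pexpl // prime_coprime // dvdn_prime2.
have co_ls : coprime l (\prod_(p0 <- s) p0)%N.
  rewrite prime_coprime // Euclid_dvd_prod // big_has; apply/hasPn=> p0 sp0 /=.
  rewrite dvdn_prime2 ?(allP s_pr p0) //.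
  by apply: contra nsp => /eqP eq_l; rewrite -eq_lp eq_l.
rewrite Gauss_dvdl ?coprime_pexpl // -eq_lp; apply/negP=> /dvdn_leq => /(_ l_gt0).
by rewrite -mulnn; nia.
Qed.

Lemma PT_single_square G (p : nat) :
  cyclic G -> G :!=: 1 -> prime p -> single_square #|G| p -> PT_property G.
Proof.
move=> cycG ntG p_pr sqG; have [pG | p'G] := boolP (p %| #|G|).
  exact: PT_single_square_dvd sqG.
(* Here [|G|] is square-free, so any of its prime divisors can replace [p]. *)
have G_gt1 : 1 < #|G| by rewrite cardG_gt1.
apply: (PT_single_square_dvd cycG (pdiv_prime G_gt1) (pdiv_dvd _)) => l l_pr _.
have [-> | ] := eqVneq l p; last exact: sqG.
by apply: contra p'G; apply: dvdn_trans; rewrite -mulnn dvdn_mulr.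
Qed.

End Tilings.

(** Cyclic groups have a subgroup of each order dividing theirs and are determined by their order;
    embedding becomes divisibility. *)
Lemma isog_subgroup_ZP (gT : finGroupType) (G : {group gT}) (M : nat) :
  cyclic G -> 1 < M -> isog_subgroup_Z G M <-> #|G| %| M.
Proof.
move=> cycG M_gt1.
have cardM : #|[set: 'Z_M]| = M by rewrite cardsT card_ord Zp_cast.
have cycM : cyclic [set: 'Z_M] by rewrite Zp_cycle cycle_cyclic.
split=> [[H /card_isog ->] | dvM].
  by rewrite -[X in _ %| X]cardM cardSg ?subsetT.
have [|z _ oz] := @cyclic_order_exists _ [set: 'Z_M]%G #|G| cycM.
  by rewrite cardM.
exists <[z]>%G; rewrite isog_cyclic_card // cycle_cyclic /=.
by rewrite -orderE oz.
Qed.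

Theorem theorem1p1 (gT : finGroupType) (G : {group gT})
    (cycG : cyclic G) (ntG : G :!=: 1) :
  PT_property G <->
  ((exists (p1 : nat) (ps : seq nat) (n : nat),
      [/\ all prime (p1 :: ps), uniq (p1 :: ps), (1 <= n)%N &
          isog_subgroup_Z G (p1 ^ n * \prod_(p <- ps) p)%N])
   \/
   (exists p1 p2 : nat,
      [/\ prime p1, prime p2, p1 != p2 &
          isog_subgroup_Z G (p1 ^ 2 * p2 ^ 2)%N])).
Proof.
have G_gt1 : 1 < #|G| by rewrite cardG_gt1.
have G_gt0 := cardG_gt0 G.
split=> [PT_G | [[p1 [ps [n [ps_pr ps_uniq n_gt0]]]] | [p [q [p_pr q_pr ne_pq]]]]].
- have [/hasP[p pG /hasP[q qG /andP[ne_pq dvG]]] | /hasPn noG] := boolP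
    (has (fun p => has (fun q => (p != q) && (p ^ 2 * q ^ 2 %| #|G|)%N)
       (primes #|G|)) (primes #|G|)).
    move: pG qG; rewrite !mem_primes => /and3P[p_pr _ _] /and3P[q_pr _ _].
    right; exists p, q; split=> //.
    have [p_gt1 q_gt1] := (prime_gt1 p_pr, prime_gt1 q_pr).
    have [eqG | neG] := eqVneq #|G| (p ^ 2 * q ^ 2)%N.
      by apply/isog_subgroup_ZP; rewrite // -eqG.
    by case: (@two_squares_not_PT _ G p q).
  (* At most one prime is squared in [|G|]; [p1] is that prime, or the least prime divisor if there
     is none. *)
  have [p1 [p1_pr p1G sqG]] : exists p1, [/\ prime p1, p1 %| #|G| & single_square #|G| p1].
    have [/hasP[p pG p2G] | /hasPn no2] := boolP (has (fun p => p ^ 2 %| #|G|)%N (primes #|G|)).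
      move: (pG); rewrite mem_primes => /and3P[p_pr _ pdvG]; exists p; split=> //.
      move=> l l_pr ne_lp; apply/negP=> l2G.
      have lG : l \in primes #|G|.
        by rewrite mem_primes l_pr G_gt0 (dvdn_trans _ l2G) // -mulnn dvdn_mulr.
      have /hasPn/(_ l lG) := noG p pG; rewrite eq_sym ne_lp Gauss_dvd ?p2G ?l2G //.
      by rewrite coprime_pexpl // coprime_pexpr // prime_coprime // dvdn_prime2 // eq_sym.
    exists (pdiv #|G|); rewrite pdiv_prime ?pdiv_dvd //; split=> // l l_pr _.
    apply/negP=> l2G; have lG : l \in primes #|G|.
      by rewrite mem_primes l_pr G_gt0 (dvdn_trans _ l2G) // -mulnn dvdn_mulr.
    by have := no2 l lG; rewrite l2G.
  (* [p1] carries its full exponent and the other prime divisors have exponent 1, so the modulus is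
     [|G|]. *)
  left; exists p1, [seq p <- primes #|G| | p != p1], (logn p1 #|G|).
  have p1_in : p1 \in primes #|G| by rewrite mem_primes p1_pr G_gt0.
  split.
  - rewrite /= p1_pr; apply/allP=> p; rewrite mem_filter mem_primes.
    by case/and4P.
  - by rewrite /= mem_filter eqxx filter_uniq ?primes_uniq.
  - by rewrite logn_gt0.
  set M := (_ * _)%N; suffices eqM : #|G| = M by apply/isog_subgroup_ZP; rewrite -?eqM.
  rewrite {1}(prod_prime_decomp G_gt0) prime_decompE big_map /=.
  rewrite (bigD1_seq p1) ?primes_uniq //= /M big_filter; congr (_ * _)%N.
  rewrite big_seq_cond [RHS]big_seq_cond; apply: eq_bigr => p /andP[pG ne_p].
  have: logn p #|G| < 2.
    rewrite ltnNge -pfactor_dvdn //; last by move: pG; rewrite mem_primes => /and3P[].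
    by apply: sqG => //; move: pG; rewrite mem_primes => /and3P[].
  by have := pG; rewrite -logn_gt0; case: (logn p _) => [|[]].
- have /andP[p1_pr s_pr] := ps_pr; have /andP[nsp1 s_uniq] := ps_uniq.
  have M_gt0 : 0 < \prod_(p <- ps) p.
    by rewrite big_seq prodn_cond_gt0 // => p /(allP s_pr)/prime_gt0.
  have M_gt1 : 1 < p1 ^ n * \prod_(p <- ps) p.
    apply: leq_trans (leq_pmulr _ M_gt0).
    by rewrite -(exp1n n) ltn_exp2r // prime_gt1.
  move/(isog_subgroup_ZP cycG M_gt1) => dvM.
  apply: (PT_single_square cycG ntG p1_pr) => l l_pr ne_l.
  (* [l^2] is prime to [p1^n], so it would divide the square-free product. *)
  apply: contra (prod_primes_square_free s_pr s_uniq l_pr) => l2G.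
  rewrite -(Gauss_dvdr (m := l ^ 2) (n := p1 ^ n)); first exact: dvdn_trans dvM.
  by rewrite coprime_pexpl // coprime_pexpr // prime_coprime // dvdn_prime2.
have [p_gt0 q_gt0] := (prime_gt0 p_pr, prime_gt0 q_pr).
have [p_gt1 q_gt1] := (prime_gt1 p_pr, prime_gt1 q_pr).
have M_gt1 : 1 < p ^ 2 * q ^ 2 by rewrite -!mulnn; nia.
move/(isog_subgroup_ZP cycG M_gt1) => dvM.
have co_sq l m : prime l -> prime m -> l != m -> coprime (l ^ 2) (m ^ 2).
  by move=> *; rewrite coprime_pexpl // coprime_pexpr // prime_coprime // dvdn_prime2.
have sq_ndvd l m : prime l -> prime m -> l != m -> ~ l ^ 2 %| m ^ 2.
  move=> l_pr m_pr ne_lm l2m; have: l %| m ^ 2.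
    by apply: dvdn_trans l2m; rewrite -mulnn dvdn_mulr.
  by rewrite Euclid_dvdX // dvdn_prime2 // (negPf ne_lm).
(* A divisor of [p^2 q^2] missing [p^2] or [q^2] has at most one squared prime; otherwise it is
   [p^2 q^2]. *)
have [p2G | np2G] := boolP (p ^ 2 %| #|G|)%N; last first.
  apply: (PT_single_square cycG ntG q_pr) => l l_pr ne_l.
  have [-> // | ne_lp] := eqVneq l p; apply/negP=> /dvdn_trans/(_ dvM).
  by rewrite Gauss_dvdl ?co_sq //; apply: sq_ndvd.
have [q2G | nq2G] := boolP (q ^ 2 %| #|G|)%N; last first.
  apply: (PT_single_square cycG ntG p_pr) => l l_pr ne_l.
  have [-> // | ne_lq] := eqVneq l q; apply/negP=> /dvdn_trans/(_ dvM).
  by rewrite Gauss_dvdr ?co_sq //; apply: sq_ndvd.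
apply: (PT_two_squares cycG p_pr q_pr ne_pq).
by apply/eqP; rewrite eqn_dvd dvM Gauss_dvd ?co_sq // p2G.
Qed.
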